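(* Let $(X,\mathcal{LSS}_X)$ and $(Y,\mathcal{LSS}_Y)$ be large scale spaces and let $f:X\to Y$ be a coarse equivalence. Then $(X,\mathcal{LSS}_X)$ has bounded scale measure if and only if $(Y,\mathcal{LSS}_Y)$ has bounded scale measure.
   Context: For a family $\mathcal{U}$ of subsets of a set $X$ and $V\subseteq X$, the star is $\mathrm{st}(V,\mathcal{U})=\bigcup\{U\in\mathcal{U}: U\cap V\neq\varnothing\}$; for a family $\mathcal{V}$ of subsets, $\mathrm{st}(\mathcal{V},\mathcal{U})=\{\mathrm{st}(V,\mathcal{U}): V\in\mathcal{V}\}$. A large scale structure on $X$ is a non-empty set $\mathcal{LSS}$ of families of subsets of $X$ such that: (1) if $\mathcal{V}\in\mathcal{LSS}$ and $\mathcal{U}$ is a family of subsets of $X$ such that each element of $\mathcal{U}$ consisting of more than one point is contained in some element of $\mathcal{V}$, then $\mathcal{U}\in\mathcal{LSS}$; (2) if $\mathcal{U},\mathcal{V}\in\mathcal{LSS}$, then $\mathrm{st}(\mathcal{U},\mathcal{V})\in\mathcal{LSS}$. The pair $(X,\mathcal{LSS})$ is a large scale space. Elements of $\mathcal{LSS}$ are called uniformly bounded families. A scale of $X$ is a family of subsets of $X$ that covers $X$; a uniformly bounded scale is a scale of $X$ belonging to $\mathcal{LSS}$. A map $f:X\to Y$ between large scale spaces is large scale continuous if $f(\mathcal{U})=\{f(U):U\in\mathcal{U}\}\in\mathcal{LSS}_Y$ for every $\mathcal{U}\in\mathcal{LSS}_X$. Two maps $f,g:X\to Y$ are close if there is $\mathcal{V}\in\mathcal{LSS}_Y$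 such that for every $x\in X$ there is $V\in\mathcal{V}$ with $f(x),g(x)\in V$. A large scale continuous map $f:X\to Y$ is a coarse equivalence if there is a large scale continuous map $g:Y\to X$ such that $f\circ g$ is close to $\mathrm{id}_Y$ and $g\circ f$ is close to $\mathrm{id}_X$. Given a scale $\mathcal{U}$ of $X$ and $A\subseteq X$, a $\mathcal{U}$-net in (or of) $A$ is a subset $B\subseteq A$ that is maximal (with respect to inclusion) among subsets of $A$ having the property that no two distinct elements of $B$ belong to the same element of $\mathcal{U}$. $(X,\mathcal{LSS})$ has bounded scale measure if there is a uniformly bounded scale $\mathcal{U}\in\mathcal{LSS}$ such that for every uniformly bounded scale $\mathcal{V}\in\mathcal{LSS}$ there exists a natural number $u(\mathcal{V})$ such that for all $V\in\mathcal{V}$, every $\mathcal{U}$-net of $V$ has at most $u(\mathcal{V})$ elements. *)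

(* Defs.v *)
From mathcomp Require Import all_boot.
From mathcomp Require Import boolp classical_sets functions cardinality.

Set Implicit Arguments.
Unset Strict Implicit.
Unset Printing Implicit Defensive.

Local Open Scope classical_set_scope.
Local Open Scope card_scope.

Definition star {X : Type} (V : set X) (UU : set (set X)) : set X :=
  \bigcup_(U in [set U | UU U /\ U `&` V !=set0]) U.

Definition star_family {X : Type} (VV UU : set (set X)) : set (set X) :=
  [set star V UU | V in VV].

Definition more_than_one_point {X : Type} (U : set X) : Prop :=
  exists x y, [/\ U x, U y & x <> y].

Record large_scale_structure (X : Type) := LargeScaleStructure {
  uniformly_bounded : set (set (set X));
  uniformly_bounded_nonempty : uniformly_bounded !=set0;
  uniformly_bounded_refine : forall VV UU : set (set X),
    uniformly_bounded VV ->
    (forall U, UU U -> more_than_one_point U ->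
       exists2 V, VV V & U `<=` V) ->
    uniformly_bounded UU;
  uniformly_bounded_star : forall UU VV : set (set X),
    uniformly_bounded UU -> uniformly_bounded VV ->
    uniformly_bounded (star_family UU VV)
}.

Definition scale {X : Type} (UU : set (set X)) : Prop :=
  \bigcup_(U in UU) U = setT.

Definition uniformly_bounded_scale {X : Type} (L : large_scale_structure X)
    (UU : set (set X)) : Prop :=
  scale UU /\ uniformly_bounded L UU.

Definition large_scale_continuous {X Y : Type} (LX : large_scale_structure X)
    (LY : large_scale_structure Y) (f : X -> Y) : Prop :=
  forall UU : set (set X),
    uniformly_bounded LX UU -> uniformly_bounded LY [set f @` U | U in UU].

Definition close {X Y : Type} (LY : large_scale_structure Y) (f g : X -> Y) :
    Prop :=
  exists2 VV : set (set Y), uniformly_bounded LY VV &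
    forall x, exists2 V, VV V & V (f x) /\ V (g x).

Definition coarse_equivalence {X Y : Type} (LX : large_scale_structure X)
    (LY : large_scale_structure Y) (f : X -> Y) : Prop :=
  large_scale_continuous LX LY f /\
  exists g : Y -> X,
    [/\ large_scale_continuous LY LX g, close LY (f \o g) id &
        close LX (g \o f) id].

Definition separated_by {X : Type} (UU : set (set X)) (B : set X) : Prop :=
  forall x y, B x -> B y -> x <> y -> ~ exists2 U, UU U & U x /\ U y.

Definition net {X : Type} (UU : set (set X)) (A B : set X) : Prop :=
  [/\ B `<=` A, separated_by UU B &
      forall C : set X, C `<=` A -> separated_by UU C -> B `<=` C -> C = B].

(* [B #<= `I_n] says that B is finite with at most n elements. *)
Definition bounded_scale_measure {X : Type} (L : large_scale_structure X) :
    Prop :=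
  exists2 UU : set (set X), uniformly_bounded_scale L UU &
    forall VV : set (set X), uniformly_bounded_scale L VV ->
      exists n : nat, forall V B : set X, VV V -> net UU V B -> B #<= `I_n.

(* Main.v *)
Require Import Defs.
From mathcomp Require Import all_boot.
From mathcomp Require Import boolp classical_sets functions cardinality.

(** Bounded scale measure passes backwards along any large scale continuous
    map [g : Y -> X] that has a large scale continuous left inverse [f] up to
    closeness; a coarse equivalence and its coarse inverse are both such maps,
    which gives the two implications.

    Let [UU] be a scale of [X] witnessing bounded scale measure, and use on
    [Y] the scale of all preimages [g @^-1` U]. It is uniformly bounded, since
    a point [y] with [g y] in [U] is close to [f (g y)], so that
    [g @^-1` U] lies in a star of [f @` U] ([uniformly_bounded_preimage]).
    Moreover two points of [Y] share a preimage exactly when their images share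
    a member of [UU]. Hence [g] maps a set [B] separated by the preimages
    bijectively onto a set separated by [UU] ([separated_by_image],
    [separated_by_inj]). If [B] lies in [V], then [g @` B] lies in [g @` V] and
    extends, by Zorn's lemma, to a [UU]-net of [g @` V]
    ([separated_by_sub_net]), whose cardinality is bounded uniformly in [V]. *)

Set Implicit Arguments.
Unset Strict Implicit.
Unset Printing Implicit Defensive.

Local Open Scope classical_set_scope.
Local Open Scope card_scope.

(** Being separated is a condition on pairs of points, so it survives unions
    of chains and Zorn's lemma applies. *)
Lemma separated_by_sub_net (X : Type) (UU : set (set X)) (A B : set X) :
  B `<=` A -> separated_by UU B -> exists2 C, net UU A C & B `<=` C.
Proof.
move=> BA sB.
(* The condition bears on [B `|` C] rather than on supersets of [B], so that it
   also holds for the union of the empty chain. *)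
pose P : set (set X) := [set C | C `<=` A /\ separated_by UU (B `|` C)].
have [F FP totF|M [[MA sM] maxM]] := @Zorn_bigcup X P.
  split=> [x [C FC Cx]|]; first exact: (FP C FC).1 x Cx.
  move=> x y [Bx|[C FC Cx]] [By|[D FD Dy]].
  - exact: sB.
  - by apply: (FP D FD).2; [left|right].
  - by apply: (FP C FC).2; [right|left].
  - have [CD|DC] := totF C D FC FD.
    + by apply: (FP D FD).2; right => //; exact: CD.
    + by apply: (FP C FC).2; right => //; exact: DC.
exists (B `|` M); last exact: subsetUl.
split=> [||C CA sC BMC] //; first by rewrite subUset.
have MC : M `<=` C by move=> x Mx; apply: BMC; right.
have BC : B `<=` C by move=> x Bx; apply: BMC; left.
apply/seteqP; split=> // x Cx; right; apply: contrapT => nMx.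
apply: (maxM C); first by split=> // CM; exact: nMx (CM _ Cx).
by split=> //; rewrite (setUidr BC).
Qed.

(** Singletons come for free in a large scale structure, so the bound in the
    definition of bounded scale measure also holds for uniformly bounded
    families that do not cover; and by [separated_by_sub_net] it holds for
    separated sets that are not maximal. *)
Lemma bounded_scale_measure_separated (X : Type) (L : large_scale_structure X) :
  bounded_scale_measure L ->
  exists2 UU, uniformly_bounded_scale L UU &
    forall VV, uniformly_bounded L VV -> exists n : nat,
      forall V B, VV V -> B `<=` V -> separated_by UU B -> B #<= `I_n.
Proof.
move=> [UU UUs UUn]; exists UU => // VV VVb.
pose WW : set (set X) := VV `|` range set1.
have WWs : uniformly_bounded_scale L WW.
  split; first by apply/seteqP; split=> // x _; exists [set x] => //; right; exists x.
  apply: uniformly_bounded_refine VVb _ => U [VU _|[x _ <-]]; first by exists U.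
  by move=> [y [z [-> ->]]].
have [n nP] := UUn WW WWs; exists n => V B VVV BV sB.
have [C Cnet BC] := separated_by_sub_net BV sB.
by apply: card_le_trans (subset_card_le BC) (nP V C _ Cnet); left.
Qed.

Definition preimage_family (X Y : Type) (g : Y -> X) (UU : set (set X)) :
  set (set Y) := [set g @^-1` U | U in UU].

Lemma scale_preimage (X Y : Type) (g : Y -> X) (UU : set (set X)) :
  scale UU -> scale (preimage_family g UU).
Proof.
move=> sUU; apply/seteqP; split=> // y _.
have [U UUU Ugy] : (\bigcup_(U in UU) U) (g y) by rewrite sUU.
by exists (g @^-1` U) => //; exists U.
Qed.

Lemma uniformly_bounded_preimage (X Y : Type) (LX : large_scale_structure X)
    (LY : large_scale_structure Y) (f : X -> Y) (g : Y -> X)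
    (UU : set (set X)) :
  large_scale_continuous LX LY f -> close LY (f \o g) id ->
  uniformly_bounded LX UU -> uniformly_bounded LY (preimage_family g UU).
Proof.
move=> fc [WW WWb fgW] UUb.
apply: uniformly_bounded_refine
  (uniformly_bounded_star (fc _ UUb) WWb) _ => _ [U UUU <-] _.
exists (star (f @` U) WW); first by exists (f @` U) => //; exists U.
move=> y Ugy; have [W WWW [Wfgy Wy]] := fgW y.
by exists W => //; split=> //; exists (f (g y)); split=> //; exists (g y).
Qed.

Lemma separated_by_image (X Y : Type) (g : Y -> X) (UU : set (set X))
    (B : set Y) :
  separated_by (preimage_family g UU) B -> separated_by UU (g @` B).
Proof.
move=> sB _ _ [x Bx <-] [y By <-] gxy [U UUU Uxy].
apply: (sB x y Bx By); first by move=> xy; apply: gxy; rewrite xy.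
by exists (g @^-1` U) => //; exists U.
Qed.

(** The fibres of [g] lie inside preimages because [UU] covers. *)
Lemma separated_by_inj (X Y : Type) (g : Y -> X) (UU : set (set X))
    (B : set Y) :
  scale UU -> separated_by (preimage_family g UU) B -> {in B &, injective g}.
Proof.
move=> sUU sB x y /set_mem Bx /set_mem By gxy; apply: contrapT => nxy.
have [U UUU Ugx] : (\bigcup_(U in UU) U) (g x) by rewrite sUU.
apply: (sB x y Bx By nxy); exists (g @^-1` U); first by exists U.
by split=> //=; rewrite -gxy.
Qed.

Lemma bounded_scale_measure_coarse_left_inverse (X Y : Type)
    (LX : large_scale_structure X) (LY : large_scale_structure Y)
    (f : X -> Y) (g : Y -> X) :
  large_scale_continuous LX LY f -> large_scale_continuous LY LX g ->
  close LY (f \o g) id ->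
  bounded_scale_measure LX -> bounded_scale_measure LY.
Proof.
move=> fc gc fg /bounded_scale_measure_separated[UU [sUU UUb] UUn].
exists (preimage_family g UU).
  by split; [exact: scale_preimage|exact: uniformly_bounded_preimage fc fg UUb].
move=> VV [_ /gc gVVb]; have [n nP] := UUn _ gVVb.
exists n => V B VVV [BV sB _].
have gBn : g @` B #<= `I_n.
  apply: (nP (g @` V)); first by exists V.
  - exact: image_subset.
  - exact: separated_by_image.
by rewrite -(card_le_eql (inj_card_eq (separated_by_inj sUU sB))).
Qed.

Theorem theorem2p6 (X Y : Type) (LX : large_scale_structure X)
  (LY : large_scale_structure Y) (f : X -> Y)
  (hf : coarse_equivalence LX LY f) :
  bounded_scale_measure LX <-> bounded_scale_measure LY.
Proof.
have [fc [g [gc fg gf]]] := hf.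
by split; [exact: bounded_scale_measure_coarse_left_inverse fc gc fg
          |exact: bounded_scale_measure_coarse_left_inverse gc fc gf].
Qed.
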